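(* Let $I$ be a right ideal in $(\mathbb{H}[q_1,q_2],+,* )$. Then $\mathcal{J}(\mathcal{V}(I))=\sqrt{I}$. Moreover, $\sqrt{I}$ coincides with the ideal of all polynomials in $\mathbb{H}[q_1,q_2]$ vanishing at every point of $\mathcal{V}(I)$.
   Context: $\mathbb{H}$ denotes the skew field of quaternions. $\mathbb{H}[q_1,q_2]$ is the set of slice regular polynomials in two quaternionic variables, i.e. functions $P:\mathbb{H}^2\to\mathbb{H}$ of the form $P(q_1,q_2)=\sum_{n,m}q_1^nq_2^m a_{n,m}$ (finite sum, $a_{n,m}\in\mathbb{H}$ on the right, evaluated in exactly this order at arbitrary points of $\mathbb{H}^2$). The $*$-product is the biadditive extension of $(q_1^nq_2^ma)*(q_1^rq_2^sb)=q_1^{n+r}q_2^{m+s}ab$; it makes $\mathbb{H}[q_1,q_2]$ a noncommutative associative ring. A right ideal is a subset $I$ closed under addition with $Q*P\in I$ for all $Q\in I$, $P\in\mathbb{H}[q_1,q_2]$. For a right ideal $I$, $\mathcal{V}(I)=\{(a,b)\in\mathbb{H}^2 : P(a,b)=0 \text{ for all } P\in I\}$. For $Z\subseteq\mathbb{H}^2$, $\mathcal{J}(Z)$ is the right ideal generated by the polynomials vanishing on $Z$: $\mathcal{J}(Z)=\{\sum_{k=1}^N P_k*Q_k : N\ge 1,\ P_k,Q_k\in\mathbb{H}[q_1,q_2],\ P_k|_Z\equiv 0\}$ (for $Z=\varnothing$ this is the whole ring). A right ideal $I$ is completely prime if for any $P,Q\in\mathbb{H}[q_1,q_2]$ such that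 $P*Q\in I$ and $P*I\subseteq I$ (where $P*I=\{P*R: R\in I\}$) one has $P\in I$ or $Q\in I$. The right radical $\sqrt{I}$ is the intersection of all completely prime right ideals containing $I$. *)

(* Defs.v *)
From HB Require Import structures.
From mathcomp Require Import all_boot all_order all_algebra.
From mathcomp Require Import boolp classical_sets reals.
From mathcomp Require Import ring.
Set Implicit Arguments.
Unset Strict Implicit.
Unset Printing Implicit Defensive.
Import Order.TTheory GRing.Theory Num.Theory.
Local Open Scope classical_set_scope.
Local Open Scope ring_scope.

(* Quat a b c d is the quaternion a + b i + c j + d k. *)
Record quat (R : realType) := Quat { qre : R; qi : R; qj : R; qk : R }.

Section QuaternionRing.
Variable R : realType.
Implicit Types x y z : quat R.

Definition tuple_of_quat x : R * R * R * R := (qre x, qi x, qj x, qk x).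
Definition quat_of_tuple (t : R * R * R * R) : quat R :=
  Quat t.1.1.1 t.1.1.2 t.1.2 t.2.

Lemma tuple_of_quatK : cancel tuple_of_quat quat_of_tuple.
Proof. by case. Qed.

HB.instance Definition _ := Choice.copy (quat R) (can_type tuple_of_quatK).

Definition qzero : quat R := Quat 0 0 0 0.
Definition qone : quat R := Quat 1 0 0 0.
Definition qopp x : quat R := Quat (- qre x) (- qi x) (- qj x) (- qk x).
Definition qadd x y : quat R :=
  Quat (qre x + qre y) (qi x + qi y) (qj x + qj y) (qk x + qk y).
(* Hamilton's product: i^2 = j^2 = k^2 = ijk = -1. *)
Definition qmul x y : quat R :=
  Quat (qre x * qre y - qi x * qi y - qj x * qj y - qk x * qk y)
       (qre x * qi y + qi x * qre y + qj x * qk y - qk x * qj y)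
       (qre x * qj y - qi x * qk y + qj x * qre y + qk x * qi y)
       (qre x * qk y + qi x * qj y - qj x * qi y + qk x * qre y).

Fact qaddA : associative qadd.
Proof. by move=> x y z; rewrite /qadd /= !addrA. Qed.
Fact qaddC : commutative qadd.
Proof. by move=> x y; congr Quat; rewrite addrC. Qed.
Fact qadd0 : left_id qzero qadd.
Proof. by case=> a b c d; rewrite /qadd /= !add0r. Qed.
Fact qaddN : left_inverse qzero qopp qadd.
Proof. by move=> x; rewrite /qadd /= !addNr. Qed.

HB.instance Definition _ :=
  GRing.isZmodule.Build (quat R) qaddA qaddC qadd0 qaddN.

Fact qmulA : associative qmul.
Proof. by move=> x y z; congr Quat => /=; ring. Qed.
Fact qmul1l : left_id qone qmul.
Proof. by case=> a b c d; congr Quat => /=; ring. Qed.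
Fact qmul1r : right_id qone qmul.
Proof. by case=> a b c d; congr Quat => /=; ring. Qed.
Fact qmulDl : left_distributive qmul qadd.
Proof. by move=> x y z; congr Quat => /=; ring. Qed.
Fact qmulDr : right_distributive qmul qadd.
Proof. by move=> x y z; congr Quat => /=; ring. Qed.
Fact qone_neq0 : qone != qzero.
Proof. by apply/eqP => -[] /eqP; rewrite oner_eq0. Qed.

HB.instance Definition _ := GRing.Zmodule_isNzRing.Build (quat R)
  qmulA qmul1l qmul1r qmulDl qmulDr qone_neq0.

End QuaternionRing.

(* H[q1, q2]: the outer variable is q1, the inner one is q2, and P`_n`_m is the
   coefficient a_{n,m} of q1^n q2^m.  In {poly _} the variables commute with the
   coefficients, so the product of {poly {poly _}} is the *-product
   (q1^n q2^m a) * (q1^r q2^s b) = q1^{n+r} q2^{m+s} a b (lemma qmonoM); by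
   lemma qeval_inj the polynomials may be identified with the functions they
   define on H^2. *)
Notation slice_poly R := {poly {poly (quat R)}}.

Section SliceRegularPolynomials.
Variable R : realType.
Local Notation H := (quat R).
Implicit Types (P Q : slice_poly R) (I : set (slice_poly R)) (Z : set (H * H)).

(* The coefficients are on the right; the Horner evaluation of {poly _} would
   put them on the left. *)
Definition qeval P (z : H * H) : H :=
  \sum_(n < size P) \sum_(m < size P`_n) z.1 ^+ n * z.2 ^+ m * P`_n`_m.

(* The subset is required to contain 0, so that the empty set is excluded. *)
Definition right_ideal I : Prop :=
  [/\ I 0, (forall P Q, I P -> I Q -> I (P + Q))
         & (forall P Q, I P -> I (P * Q))].

Definition zero_locus I : set (H * H) :=
  [set z | forall P, I P -> qeval P z = 0].

Definition vanishing Z : set (slice_poly R) :=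
  [set P | forall z, Z z -> qeval P z = 0].

Definition Jideal Z : set (slice_poly R) :=
  [set F | exists N : nat, exists P Q : 'I_N -> slice_poly R,
    [/\ (1 <= N)%N, (forall k, vanishing Z (P k))
      & F = \sum_(k < N) P k * Q k]].

(* The whole ring counts as completely prime, so right_radical I = setT when no
   proper completely prime right ideal contains I. *)
Definition completely_prime I : Prop :=
  right_ideal I /\
  forall P Q, I (P * Q) -> [set P * S | S in I] `<=` I -> I P \/ I Q.

Definition right_radical I : set (slice_poly R) :=
  \bigcap_(K in [set K | completely_prime K /\ I `<=` K]) K.

Definition qmono (n m : nat) (a : H) : slice_poly R := (a%:P * 'X^m)%:P * 'X^n.

Lemma qmonoM n m r s (a b : H) :
  qmono n m a * qmono r s b = qmono (n + r) (m + s) (a * b).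
Proof.
rewrite /qmono mulrA -(mulrA _ 'X^n) -(commr_polyXn _ n) mulrA -polyCM -mulrA.
rewrite -exprD; congr (_%:P * _).
by rewrite mulrA -(mulrA _ 'X^m) -(commr_polyXn _ m) mulrA -polyCM -mulrA exprD.
Qed.

Lemma qevalE (N M : nat) P z : (size P <= N)%N -> (forall n, (size (P`_n)%R <= M)%N) ->
  qeval P z = \sum_(n < N) \sum_(m < M) z.1 ^+ n * z.2 ^+ m * P`_n`_m.
Proof.
move=> leN leM; pose F n m := z.1 ^+ n * z.2 ^+ m * P`_n`_m.
have E n : \sum_(m < size P`_n) F n m = \sum_(m < M) F n m.
  rewrite (big_ord_widen M (F n)) // big_mkcond; apply: eq_bigr => m _.
  by case: ltnP => // h; rewrite /F nth_default ?mulr0.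
rewrite /qeval (eq_bigr _ (fun (n : 'I_(size P)) _ => E n)).
rewrite (big_ord_widen N (fun n => \sum_(m < M) F n m)) // big_mkcond.
apply: eq_bigr => n _; case: ltnP => // h; rewrite big1 // => m _.
by rewrite /F [P`_n]nth_default // coef0 mulr0.
Qed.

Lemma coef_qmono n m (a : H) k l :
  (qmono n m a)`_k`_l = if (k == n) && (l == m) then a else 0.
Proof.
rewrite /qmono coefCM coefXn; case: (k == n) => /=; last by rewrite mulr0 coef0.
by rewrite mulr1 coefCM coefXn; case: (l == m); rewrite ?mulr1 ?mulr0.
Qed.

Lemma qeval_mono n m (a : H) z :
  qeval (qmono n m a) z = z.1 ^+ n * z.2 ^+ m * a.
Proof.
rewrite (@qevalE n.+1 m.+1).
- rewrite (bigD1 ord_max) //= (bigD1 ord_max) //= coef_qmono !eqxx /=.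
  rewrite !big1 ?addr0 // => i ne; last first.
    by rewrite coef_qmono (negbTE ne : (i == m :> nat) = _) andbF mulr0.
  rewrite big1 // => j _.
  by rewrite coef_qmono (negbTE ne : (i == n :> nat) = _) mulr0.
- apply/leq_sizeP => j lj; apply/polyP => k.
  by rewrite coef_qmono coef0 gtn_eqF.
- move=> k; apply/leq_sizeP => j lj.
  by rewrite coef_qmono (gtn_eqF lj) andbF.
Qed.

Let poly_inj0 (A : idomainType) (f : nat -> A) (p : {poly A}) :
  injective f -> (forall i, p.[f i] = 0) -> p = 0.
Proof.
move=> fI p0; apply: (@roots_geq_poly_eq0 _ _ (map f (iota 0 (size p)))).
- by apply/allP => _ /mapP[i _ ->]; apply/rootP.
- by rewrite map_inj_uniq ?iota_uniq.
- by rewrite size_map size_iota.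
Qed.

Lemma qeval_inj P Q : qeval P = qeval Q -> P = Q.
Proof.
move=> ePQ.
pose N := maxn (size P) (size Q).
pose M := maxn (\max_(n < N) size (P`_n)%R) (\max_(n < N) size (Q`_n)%R).
have bnd (S : slice_poly R) n : (size S <= N)%N -> (size (S`_n)%R <= \max_(n < N) size (S`_n)%R)%N.
  move=> leN; case: (ltnP n N) => h.
    exact: (leq_bigmax (F := fun n : 'I_N => size (S`_n)%R) (Ordinal h)).
  by rewrite [S`_n]nth_default ?size_poly0 // (leq_trans leN).
have [PN QN] : (size P <= N)%N /\ (size Q <= N)%N by rewrite leq_maxl leq_maxr.
have PM n : (size (P`_n)%R <= M)%N by rewrite (leq_trans (bnd P n PN)) ?leq_maxl.
have QM n : (size (Q`_n)%R <= M)%N by rewrite (leq_trans (bnd Q n QN)) ?leq_maxr.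
pose rl (x : R) : H := Quat x 0 0 0.
have rlM x y : rl x * rl y = rl (x * y).
  by congr Quat; rewrite /= ?(mulr0, mul0r, subr0, addr0).
have rlX x n : rl x ^+ n = rl (x ^+ n).
  by elim: n => // n IH; rewrite !exprS IH rlM.
have natI : injective (fun i : nat => i%:R : R) by exact: mulrIn (oner_neq0 R).
have key (c : H -> R) : c 0 = 0 -> {morph c : a b / a + b} ->
    (forall x a, c (rl x * a) = x * c a) ->
    forall n m, c P`_n`_m = c Q`_n`_m.
  move=> c0 cD cZ n m.
  pose p : {poly {poly R}} :=
    \poly_(n < N) \poly_(m < M) (c P`_n`_m - c Q`_n`_m).
  have p0 : p = 0.
    apply: (@poly_inj0 _ (fun i => (i%:R : R)%:P)) => [i j /polyC_inj/natI //|i].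
    apply: (@poly_inj0 _ _ _ natI) => j.
    have /(congr1 c) := congr1 (@^~ (rl i%:R, rl j%:R)) ePQ.
    rewrite (qevalE _ PN PM) (qevalE _ QN QM) !(big_morph c cD c0) => /eqP.
    rewrite -subr_eq0 -sumrB => /eqP <-.
    rewrite horner_poly horner_sum; apply: eq_bigr => k _.
    rewrite !(big_morph c cD c0) -sumrB hornerM -polyC_exp hornerC horner_poly.
    rewrite mulr_suml; apply: eq_bigr => l _.
    by rewrite /= !rlX rlM !cZ -mulrBr; ring.
  have := congr1 (fun f : {poly {poly R}} => f`_n`_m) p0.
  rewrite coef_poly !coef0; case: ltnP => [hn|hn _]; last first.
    by rewrite ![_`_n]nth_default ?(leq_trans PN) ?(leq_trans QN).
  rewrite coef_poly; case: ltnP => [hm /subr0_eq //|hm _].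
  by rewrite ![_`_m]nth_default ?(leq_trans (PM n)) ?(leq_trans (QM n)).
apply/polyP => n; apply/polyP => m.
have K0 x a : qre (rl x * a) = x * qre a by rewrite /= !mul0r !subr0.
have K1 x a : qi (rl x * a) = x * qi a by rewrite /= !mul0r !addr0 subr0.
have K2 x a : qj (rl x * a) = x * qj a by rewrite /= !mul0r subr0 !addr0.
have K3 x a : qk (rl x * a) = x * qk a by rewrite /= !mul0r addr0 subr0 addr0.
have := key (@qre R) erefl (fun _ _ => erefl) K0 n m.
have := key (@qi R) erefl (fun _ _ => erefl) K1 n m.
have := key (@qj R) erefl (fun _ _ => erefl) K2 n m.
have := key (@qk R) erefl (fun _ _ => erefl) K3 n m.
by case: (P`_n`_m) (Q`_n`_m) => [a b c d] [a' b' c' d'] /= -> -> -> ->.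
Qed.

End SliceRegularPolynomials.

(* Main.v *)
Require Import Defs.
From HB Require Import structures.
From mathcomp Require Import all_boot all_order all_algebra.
From mathcomp Require Import boolp classical_sets reals.
From mathcomp Require Import ring lra.
From mathcomp.real_closed Require Import complex.
Import Order.TTheory GRing.Theory Num.Theory.
Local Open Scope classical_set_scope.
Local Open Scope ring_scope.
Set Implicit Arguments.
Unset Strict Implicit.
Unset Printing Implicit Defensive.

(** Write A for the ring of slice regular polynomials and M_z for the set of
polynomials vanishing at a point z = (x, y).

If x y = y x, then M_z is a right ideal, because the value of P * Q at z depends
on P only through the value of P ([qevalM]), and it is completely prime, because
the quaternions have no zero divisors ([point_ideal_prime]).  If x and y do not
commute, M_z is not a right ideal, but a right ideal I vanishes at (x, y) only if
it vanishes at two points (x1, y), (x2, y) with x1, x2 conjugate to x and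
commuting with y, and vanishing at these two points implies vanishing at (x, y)
([noncommuting_zero]).  So the polynomials vanishing on the zero locus of I form
an intersection of right ideals M_z over commuting pairs: it is a right ideal,
hence equal to J(V(I)), and it contains the right radical.

For the other inclusion, let K be a completely prime right ideal and P a
polynomial outside K; a commuting zero z of K with P(z) <> 0 is needed
([completely_prime_point]).  The center of A is R[x, y], and p, the intersection
of K with R[x, y], is a prime ideal.

- Computing with traces and norms of A over its center gives a central f outside
  K in P A + K ([prime_real_witness]).
- The commutative Nullstellensatz for p gives a complex point (a, b) at which p
  vanishes and f does not ([real_nullstellensatz]).  It is obtained by eliminating
  one variable at a time ([prime_ideal_extension]).
- Every imaginary unit u embeds the complex numbers into the quaternions and turns
  (a, b) into a commuting pair z_u.  Since p contains the norms of the elements of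
  K, the evaluations of K in the algebra of complexified quaternions are all
  singular, and this forces K to vanish at z_u for some u
  ([right_ideal_slice]).

Then f(z_u) <> 0 and f lies in P A + K, so P(z_u) <> 0. *)

(** * Quaternions *)

Section Quaternions.
Variable R : realType.
Local Notation H := (quat R).
Implicit Types (x y : H) (t : R).

Lemma quatP x y :
  [/\ qre x = qre y, qi x = qi y, qj x = qj y & qk x = qk y] -> x = y.
Proof. by case: x y => [????] [????] /= [-> -> -> ->]. Qed.

Definition qconj x : H := Quat (qre x) (- qi x) (- qj x) (- qk x).
Definition qreal t : H := Quat t 0 0 0.
Definition qnorm x : R := qre x ^+ 2 + qi x ^+ 2 + qj x ^+ 2 + qk x ^+ 2.

Fact qconj_is_additive : additive qconj.
Proof. by move=> x y; apply: quatP; split=> /=; ring. Qed.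
HB.instance Definition _ := GRing.isZmodMorphism.Build H H qconj qconj_is_additive.

Fact qreal_is_additive : additive qreal.
Proof. by move=> x y; apply: quatP; split=> /=; ring. Qed.
Fact qreal_is_multiplicative : monoid_morphism qreal.
Proof. by split=> // x y; apply: quatP; split=> /=; ring. Qed.
HB.instance Definition _ := GRing.isZmodMorphism.Build R H qreal qreal_is_additive.
HB.instance Definition _ := GRing.isMonoidMorphism.Build R H qreal qreal_is_multiplicative.

Fact qre_is_additive : additive (@qre R).
Proof. by []. Qed.
HB.instance Definition _ := GRing.isZmodMorphism.Build H R (@qre R) qre_is_additive.

Lemma qconjM x y : qconj (x * y) = qconj y * qconj x.
Proof. by apply: quatP; split=> /=; ring. Qed.

Lemma qconjK : involutive qconj.
Proof. by move=> x; apply: quatP; split=> /=; ring. Qed.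

Lemma qrealC t x : qreal t * x = x * qreal t.
Proof. by apply: quatP; split=> /=; ring. Qed.

Lemma qconj_real x : qconj x = x -> x = qreal (qre x).
Proof.
move=> xE; apply: quatP; split=> //=.
- by have /(congr1 (@qi R)) /= := xE; lra.
- by have /(congr1 (@qj R)) /= := xE; lra.
- by have /(congr1 (@qk R)) /= := xE; lra.
Qed.

Lemma mul_qconj x : x * qconj x = qreal (qnorm x).
Proof. by apply: quatP; rewrite /qnorm; split=> /=; ring. Qed.

Lemma mul_conjq x : qconj x * x = qreal (qnorm x).
Proof. by apply: quatP; rewrite /qnorm; split=> /=; ring. Qed.

Lemma qnorm_eq0 x : qnorm x = 0 -> x = 0.
Proof.
rewrite /qnorm => n0.
have := sqr_ge0 (qre x); have := sqr_ge0 (qi x); have := sqr_ge0 (qj x).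
have := sqr_ge0 (qk x) => h1 h2 h3 h4.
by apply: quatP; split; apply/eqP; rewrite -sqrf_eq0; apply/eqP; move: n0 h1 h2 h3 h4; lra.
Qed.

Definition qinv x : H := qreal (qnorm x)^-1 * qconj x.

Lemma qmulV x : x != 0 -> x * qinv x = 1.
Proof.
move=> x0; rewrite /qinv mulrA -qrealC -mulrA mul_qconj -rmorphM mulVf ?rmorph1 //.
by apply: contra_neq x0 => /qnorm_eq0.
Qed.

Lemma quat_mulf_eq0 x y : x * y = 0 -> x = 0 \/ y = 0.
Proof.
move=> xy0; have [->|x0] := eqVneq x 0; [by left|right].
have : qreal (qnorm x)^-1 * (qconj x * (x * y)) = 0 by rewrite xy0 !mulr0.
rewrite !mulrA -(mulrA _ (qconj x)) mul_conjq -rmorphM mulVf ?rmorph1 ?mul1r //.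
by apply: contra_neq x0 => /qnorm_eq0.
Qed.

End Quaternions.

(** * Conjugation, trace and norm of slice regular polynomials *)

(** These constants are locked so that unification never unfolds the arithmetic
of iterated polynomials. *)
HB.lock Definition mono (R : realType) n m a : slice_poly R := qmono n m a.
HB.lock Definition qconst (R : realType) (c : quat R) : slice_poly R := c%:P%:P.
HB.lock Definition pconj (R : realType) (P : slice_poly R) : slice_poly R :=
  map_poly (map_poly (@qconj R)) P.
HB.lock Definition preal (R : realType) (f : {poly {poly R}}) : slice_poly R :=
  map_poly (map_poly (@qreal R)) f.

Section SlicePoly.
Variable R : realType.
Local Notation H := (quat R).
Local Notation A := (slice_poly R).

Implicit Types (P Q : A) (f : {poly {poly R}}) (a b c : H).

Lemma slice_polyP (P Q : A) : (forall n m, P`_n`_m = Q`_n`_m) -> P = Q.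
Proof. by move=> e; apply/polyP => n; apply/polyP. Qed.

Lemma slice_poly_ind (T : A -> Prop) : T 0 ->
  (forall P Q, T P -> T Q -> T (P + Q)) -> (forall n m a, T (mono n m a)) ->
  forall P, T P.
Proof.
move=> T0 TD Tm P.
have -> : P = \sum_(n < size P) \sum_(m < size P`_n) qmono n m P`_n`_m.
  apply: slice_polyP => n m.
  have E0 (B : nmodType) k (F : nat -> B) (i : nat) :
      \sum_(j < k) (if i == j :> nat then F i else 0) = if (i < k)%N then F i else 0.
    case: ltnP => ik; last first.
      by rewrite big1 // => j _; rewrite (gtn_eqF (leq_trans (ltn_ord j) ik)).
    rewrite (bigD1 (Ordinal ik)) //= eqxx big1 ?addr0 // => j ne.
    by rewrite eq_sym (negbTE ne : (j == i :> nat) = _).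
  rewrite !coef_sum.
  transitivity (\sum_(k < size P) if n == k then P`_n`_m else 0).
    rewrite (E0 _ _ (fun n => P`_n`_m)).
    by case: ltnP => // h; rewrite [P`_n]nth_default // coef0.
  apply: eq_bigr => k _; rewrite !coef_sum; case: eqVneq => [<-|nk]; last first.
    by rewrite big1 // => l _; rewrite coef_qmono (negPf nk).
  transitivity (\sum_(l < size P`_n) if m == l then P`_n`_m else 0).
    rewrite (E0 _ _ (fun m => P`_n`_m)).
    by case: ltnP => // h; rewrite nth_default.
  apply: eq_bigr => l _; rewrite coef_qmono eqxx /=.
  by case: eqVneq => [->|].
by do 2![elim/big_ind: _ => // ? _]; move: Tm; rewrite mono.unlock; apply.
Qed.

Lemma monoE n m a : mono n m a = (a%:P * 'X^m)%:P * 'X^n.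
Proof. by rewrite mono.unlock. Qed.

Lemma monoM n m r s (a b : H) :
  mono n m a * mono r s b = mono (n + r) (m + s) (a * b).
Proof. by rewrite mono.unlock qmonoM. Qed.

Lemma mono00 (c : H) : qconst c = mono 0 0 c.
Proof. by rewrite mono.unlock qconst.unlock /qmono !expr0 !mulr1. Qed.

Fact pconj_is_additive : additive (@pconj R : A -> A).
Proof. by move=> P Q; rewrite pconj.unlock raddfB. Qed.
HB.instance Definition _ :=
  GRing.isZmodMorphism.Build A A (@pconj R) pconj_is_additive.

Lemma coef_pconj (P : A) n m : (pconj P)`_n`_m = qconj (P`_n`_m : H).
Proof. by rewrite pconj.unlock !coef_map. Qed.

Lemma pconj_mono n m (a : H) : pconj (mono n m a) = mono n m (qconj a).
Proof.
rewrite mono.unlock.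
apply: slice_polyP => k l; apply: etrans (coef_pconj _ _ _) _.
(* explicit instances: matching against coef_qmono would unfold qmono *)
apply: etrans (congr1 _ (coef_qmono n m a k l)) (etrans _ (esym (coef_qmono _ _ _ _ _))).
by case: ifP => // _; rewrite raddf0.
Qed.

Lemma pconjM (P Q : A) : pconj (P * Q) = pconj Q * pconj P.
Proof.
elim/slice_poly_ind: P => [|P P' IH IH'|n m a].
- by rewrite mul0r raddf0 mulr0.
- by rewrite mulrDl !raddfD /= mulrDr IH IH'.
elim/slice_poly_ind: Q => [|P P' IH IH'|r s b].
- by rewrite mulr0 raddf0 mul0r.
- by rewrite mulrDr !raddfD /= mulrDl IH IH'.
by rewrite monoM !pconj_mono monoM qconjM addnC (addnC m).
Qed.

Lemma pconjK : involutive (@pconj R).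
Proof. by move=> P; apply: slice_polyP => n m; rewrite !coef_pconj qconjK. Qed.

Fact preal_is_additive : additive (@preal R).
Proof. by move=> P Q; rewrite preal.unlock raddfB. Qed.
Fact preal_is_multiplicative : monoid_morphism (@preal R).
Proof. by split=> [|P Q]; rewrite preal.unlock ?rmorph1 ?rmorphM. Qed.
HB.instance Definition _ :=
  GRing.isZmodMorphism.Build {poly {poly R}} A (@preal R) preal_is_additive.
HB.instance Definition _ :=
  GRing.isMonoidMorphism.Build {poly {poly R}} A (@preal R) preal_is_multiplicative.

Lemma prealE f : preal f = map_poly (map_poly (@qreal R)) f.
Proof. by rewrite preal.unlock. Qed.

Lemma coef_preal (f : {poly {poly R}}) n m : (preal f)`_n`_m = qreal f`_n`_m.
Proof. by rewrite preal.unlock !coef_map. Qed.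

Lemma pconj_real (P : A) : pconj P = P -> exists f, P = preal f.
Proof.
move=> PE; exists (map_poly (map_poly (@qre R)) P); apply: slice_polyP => n m.
rewrite coef_preal !coef_map; apply: qconj_real.
by rewrite -coef_pconj PE.
Qed.

Lemma poly_comm (S : nzRingType) (p q : {poly S}) :
  (forall i j, p`_i * q`_j = q`_j * p`_i) -> p * q = q * p.
Proof.
by move=> pq; apply/polyP => n; rewrite coefM coefMr; apply: eq_bigr => i _.
Qed.

Lemma prealC f (P : A) : preal f * P = P * preal f.
Proof.
apply: poly_comm => i j; apply: poly_comm => k l.
by rewrite coef_preal qrealC.
Qed.

Lemma pconj_fixC (P Q : A) : pconj P = P -> P * Q = Q * P.
Proof. by move=> /pconj_real[f ->]; apply: prealC. Qed.

(** As in a quaternion algebra, the trace and the norm take values in the center,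
which is the set of fixed points of the conjugation. *)
Definition ptr (P : A) := P + pconj P.
Definition pnorm (P : A) := P * pconj P.

Lemma pconj_tr P : pconj (ptr P) = ptr P.
Proof. by rewrite raddfD /= pconjK addrC. Qed.

Lemma pconj_norm P : pconj (pnorm P) = pnorm P.
Proof. by rewrite pconjM pconjK. Qed.

Lemma pnormC P : pconj P * P = P * pconj P.
Proof.
have -> : pconj P = ptr P - P by rewrite addrAC subrr add0r.
by rewrite mulrBl mulrBr pconj_fixC ?pconj_tr.
Qed.

Lemma pnormD P Q : pnorm (P + Q) = pnorm P + pnorm Q + ptr (P * pconj Q).
Proof.
rewrite /pnorm /ptr raddfD /= pconjM pconjK mulrDl !mulrDr.
by rewrite [X in _ + X = _]addrC addrACA.
Qed.

(** Conjugation preserves the norm; expand the norms of P + conj Q and of its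
conjugate. *)
Lemma ptrC P Q : ptr (P * Q) = ptr (Q * P).
Proof.
have normJ X : pnorm (pconj X) = pnorm X by rewrite /pnorm pconjK pnormC.
have := normJ (P + pconj Q); rewrite raddfD /= pconjK !pnormD !normJ pconjK.
move=> /addrI <-; rewrite -pconjM /ptr pconjK addrC //.
Qed.

Lemma coef_mul_const (P : A) (c : H) n m : (P * qconst c)`_n`_m = P`_n`_m * c.
Proof. by rewrite qconst.unlock !coefMC. Qed.

(** The trace form is nondegenerate: 2 q is the sum of tr(q), - tr(q i) i,
- tr(q j) j and - tr(q k) k for a quaternion q, and the coefficients of P satisfy
this identity. *)
Lemma ptr_expand P : P =
  ptr (P * qconst 1) * qconst (qreal 2^-1)
  + ptr (P * qconst (Quat 0 1 0 0)) * qconst (Quat 0 (- 2^-1) 0 0)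
  + ptr (P * qconst (Quat 0 0 1 0)) * qconst (Quat 0 0 (- 2^-1) 0)
  + ptr (P * qconst (Quat 0 0 0 1)) * qconst (Quat 0 0 0 (- 2^-1)).
Proof.
have E c n m : (ptr (P * qconst c))`_n`_m = P`_n`_m * c + qconj (P`_n`_m * c).
  have Pc := coef_mul_const P c n m.
  by rewrite -Pc -coef_pconj -!coefD.
(* f stands for a coefficient; k and t stay abstract to keep rewriting syntactic *)
have gen (f : A -> H) (k t : H -> A) : (forall X Y, f (X + Y) = f X + f Y) ->
    (forall X c, f (X * k c) = f X * c) ->
    (forall c, f (t c) = f P * c + qconj (f P * c)) ->
    f P = f (t 1 * k (qreal 2^-1)
      + t (Quat 0 1 0 0) * k (Quat 0 (- 2^-1) 0 0)
      + t (Quat 0 0 1 0) * k (Quat 0 0 (- 2^-1) 0)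
      + t (Quat 0 0 0 1) * k (Quat 0 0 0 (- 2^-1))).
  move=> fD fM fT; rewrite !fD !fM !fT.
  by case: (f P) => a b c d; apply: quatP; split=> /=; field.
apply: slice_polyP => n m.
apply: (gen (fun X : A => X`_n`_m) (@qconst R) (fun c => ptr (P * qconst c)))
  => [X Y|X c|c].
- by rewrite !coefD.
- exact: coef_mul_const.
- exact: E.
Qed.
End SlicePoly.

(** * Evaluation *)

Section CoefSum.
Variables (S : nzRingType) (B : nmodType) (tau : nat -> S -> B).
Hypothesis tau0 : forall n, tau n 0 = 0.

Lemma coef_sum_widen (p : {poly S}) N : (size p <= N)%N ->
  \sum_(n < size p) tau n p`_n = \sum_(n < N) tau n p`_n.
Proof.
move=> pN; rewrite (big_ord_widen N (fun n => tau n p`_n)) // big_mkcond.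
by apply: eq_bigr => n _; case: ltnP => // h; rewrite nth_default // tau0.
Qed.

Lemma coef_sumD (p q : {poly S}) : (forall n, {morph tau n : x y / x + y}) ->
  \sum_(n < size (p + q)%R) tau n (p + q)`_n =
  \sum_(n < size p) tau n p`_n + \sum_(n < size q) tau n q`_n.
Proof.
move=> tauD; pose N := maxn (size p) (size q).
rewrite (@coef_sum_widen _ N) ?size_polyD // (@coef_sum_widen p N) ?leq_maxl //.
rewrite (@coef_sum_widen q N) ?leq_maxr // -big_split.
by apply: eq_bigr => n _; rewrite coefD tauD.
Qed.

Lemma coef_sum_mono c k :
  \sum_(n < size (c%:P * 'X^k)) tau n (c%:P * 'X^k)`_n = tau k c.
Proof.
rewrite (@coef_sum_widen _ k.+1); last first.
  by apply/leq_sizeP => j lj; rewrite coefCM coefXn gtn_eqF // mulr0.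
rewrite big_ord_recr /= coefCM coefXn eqxx mulr1 big1 ?add0r // => i _.
by rewrite coefCM coefXn ltn_eqF // mulr0 tau0.
Qed.

End CoefSum.

Lemma expr_comm_prod (S : nzRingType) (x y : S) n m r s : x * y = y * x ->
  x ^+ (n + r) * y ^+ (m + s) = x ^+ r * y ^+ s * (x ^+ n * y ^+ m).
Proof.
move=> xy; have C : x ^+ n * y ^+ s = y ^+ s * x ^+ n.
  exact/commrX/commr_sym/commrX/commr_sym.
by rewrite addnC (addnC m) !exprD -!mulrA; congr (_ * _); rewrite !mulrA C.
Qed.

(** Evaluation at a point is the case w n m = x^n y^m.  Other weights give the
components of the values along a slice, which makes them additive and right
linear at once. *)
HB.lock Definition pairing (R : realType) (w : nat -> nat -> quat R) (P : slice_poly R) : quat R :=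
  \sum_(n < size P) \sum_(m < size P`_n) w n m * P`_n`_m.

Section Pairing.
Variable R : realType.
Local Notation H := (quat R).
Local Notation A := (slice_poly R).
Implicit Types (w : nat -> nat -> H) (P Q : A) (z : H * H).

Let pairing_in0 w n : \sum_(m < size (0 : {poly H})) w n m * (0 : {poly H})`_m = 0.
Proof. by rewrite size_poly0 big_ord0. Qed.

Lemma pairingD w P Q : pairing w (P + Q) = pairing w P + pairing w Q.
Proof.
rewrite pairing.unlock.
apply: (coef_sumD
  (tau := fun n (p : {poly H}) => \sum_(m < size p) w n m * p`_m)) => [n|n p q].
  exact: pairing_in0.
apply: (coef_sumD (tau := fun m c => w n m * c)) => [m|m x y].
  by rewrite mulr0.
by rewrite mulrDr.
Qed.

Lemma pairing_mono w n m a : pairing w (mono n m a) = w n m * a.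
Proof.
rewrite mono.unlock pairing.unlock /qmono.
rewrite (coef_sum_mono (tau := fun n (p : {poly H}) => \sum_(m < size p) w n m * p`_m)).
  by rewrite (coef_sum_mono (tau := fun m c => w n m * c)) // => k; rewrite mulr0.
by move=> k; apply: pairing_in0.
Qed.

Lemma pairing0 w : pairing w 0 = 0.
Proof. by rewrite pairing.unlock size_poly0 big_ord0. Qed.

Lemma pairing_comb w w1 w2 x P : (forall n m, w n m = w1 n m + x * w2 n m) ->
  pairing w P = pairing w1 P + x * pairing w2 P.
Proof.
move=> wE; elim/slice_poly_ind: P => [|P Q IH IH'|n m a].
- by rewrite !pairing0 mulr0 addr0.
- by rewrite !pairingD mulrDr addrACA IH IH'.
- by rewrite !pairing_mono wE mulrDl mulrA.
Qed.

Lemma pairing_mulr w P c : pairing w (P * qconst c) = pairing w P * c.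
Proof.
elim/slice_poly_ind: P => [|P Q IH IH'|n m a].
- by rewrite mul0r pairing0 mul0r.
- by rewrite mulrDl !pairingD mulrDl IH IH'.
- by rewrite mono00 monoM !pairing_mono !addn0 mulrA.
Qed.

Lemma pairing_real_mull (w : nat -> nat -> R) P c :
  pairing (fun n m => qreal (w n m)) (qconst c * P) =
  c * pairing (fun n m => qreal (w n m)) P.
Proof.
elim/slice_poly_ind: P => [|P Q IH IH'|n m a].
- by rewrite mulr0 pairing0 mulr0.
- by rewrite mulrDr !pairingD mulrDr IH IH'.
- by rewrite mono00 monoM !pairing_mono !add0n !mulrA (qrealC _ c).
Qed.

Lemma pairing_real_conj (w : nat -> nat -> R) P :
  pairing (fun n m => qreal (w n m)) (pconj P) =
  qconj (pairing (fun n m => qreal (w n m)) P).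
Proof.
elim/slice_poly_ind: P => [|P Q IH IH'|n m a].
- by rewrite raddf0 pairing0 raddf0.
- by rewrite raddfD !pairingD raddfD; congr (_ + _).
- rewrite pconj_mono !pairing_mono qconjM (qrealC _ (qconj a)); congr (_ * _).
  by apply: quatP; split=> //=; rewrite oppr0.
Qed.

Lemma qevalP z P : qeval P z = pairing (fun n m => z.1 ^+ n * z.2 ^+ m) P.
Proof. by rewrite pairing.unlock. Qed.

Lemma qeval_mon n m a z : qeval (mono n m a) z = z.1 ^+ n * z.2 ^+ m * a.
Proof. by rewrite mono.unlock qeval_mono. Qed.

Lemma qevalD P Q z : qeval (P + Q) z = qeval P z + qeval Q z.
Proof. by rewrite !qevalP pairingD. Qed.
Lemma qeval0 z : qeval 0 z = 0.
Proof. by rewrite qevalP pairing0. Qed.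
Lemma qevalMr P c z : qeval (P * qconst c) z = qeval P z * c.
Proof. by rewrite !qevalP pairing_mulr. Qed.
Lemma qevalB P Q z : qeval (P - Q) z = qeval P z - qeval Q z.
Proof. by apply/eqP; rewrite eq_sym subr_eq -qevalD subrK. Qed.
Lemma qeval_const c z : qeval (qconst c) z = c.
Proof. by rewrite mono00 qeval_mon !mul1r. Qed.

Lemma qconstD (x y : H) : qconst (x + y) = qconst x + qconst y.
Proof. by rewrite qconst.unlock !polyCD. Qed.
Lemma qconst0 : qconst (0 : H) = 0.
Proof. by rewrite qconst.unlock !polyC0. Qed.

(** When the coordinates of z commute, P(z) can be computed before the
multiplication by Q: on monomials the powers of x and y of Q can be moved to the
left of those of P. *)
Lemma qevalM P Q z : z.1 * z.2 = z.2 * z.1 ->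
  qeval (P * Q) z = qeval (qconst (qeval P z) * Q) z.
Proof.
move=> zC; elim/slice_poly_ind: Q => [|Q Q' IH IH'|r s b].
- by rewrite !mulr0.
- by rewrite !mulrDr !qevalD IH IH'.
elim/slice_poly_ind: P => [|P P' IH IH'|n m a].
- by rewrite qeval0 qconst0 !mul0r.
- by rewrite mulrDl !qevalD IH IH' qconstD mulrDl qevalD.
rewrite mono00 !monoM !qeval_mon !add0n expr_comm_prod //.
by rewrite -!mulrA.
Qed.

Definition point_ideal z : set A := [set P | qeval P z = 0].

Lemma point_ideal_right z : z.1 * z.2 = z.2 * z.1 -> right_ideal (point_ideal z).
Proof.
move=> zC; split=> [|P Q|P Q]; rewrite /point_ideal /=.
- exact: qeval0.
- by rewrite qevalD => -> ->; rewrite addr0.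
- by move=> P0; rewrite qevalM // P0 qconst0 mul0r qeval0.
Qed.

(** Q differs from the constant Q(z) by an element of M_z, so P M_z included in
M_z gives (P * Q)(z) = P(z) Q(z). *)
Lemma point_ideal_prime z : z.1 * z.2 = z.2 * z.1 ->
  completely_prime (point_ideal z).
Proof.
move=> zC; split; first exact: point_ideal_right.
rewrite /point_ideal => P Q /= PQ sub; apply: quat_mulf_eq0.
pose c := qconst (qeval Q z).
have E : P * Q = P * (Q - c) + P * c by rewrite -mulrDr subrK.
have P0 : qeval (P * (Q - c)) z = 0.
  by apply: sub; exists (Q - c) => //=; rewrite qevalB qeval_const subrr.
by rewrite -qevalMr -[LHS]add0r -{1}P0 -qevalD -E; exact: PQ.
Qed.

(** For u^2 = -1, this is the embedding of the complex numbers that maps the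
imaginary unit to u. *)
Definition slice (u : H) (a : R[i]) : H := qreal (complex.Re a) + u * qreal (complex.Im a).

Lemma sliceD u (a b : R[i]) : slice u (a + b) = slice u a + slice u b.
Proof.
case: a b => [a a'] [b b'].
by rewrite /slice /= [qreal (a + b)]rmorphD [qreal (a' + b')]rmorphD mulrDr addrACA.
Qed.

Lemma slice_real u (t : R) : slice u t%:C%C = qreal t.
Proof. by rewrite /slice /= rmorph0 mulr0 addr0. Qed.

Lemma sliceM u (a b : R[i]) : u * u = -1 -> slice u (a * b) = slice u a * slice u b.
Proof.
case: a b => [a a'] [b b'] uu; rewrite /slice /= mulrDl !mulrDr rmorphB !rmorphD !rmorphM /=.
have -> : u * qreal a' * (u * qreal b') = - (qreal a' * qreal b').
  by rewrite -mulrA (mulrA _ u) (qrealC a' u) !mulrA uu !mulN1r mulNr.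
rewrite mulrDr (mulrA (qreal a) u) (qrealC a u) !mulrA.
by rewrite addrACA (addrC (- _)).
Qed.

Lemma sliceX u (a : R[i]) n : u * u = -1 -> slice u (a ^+ n) = slice u a ^+ n.
Proof.
move=> uu; elim: n => [|n IH]; last by rewrite !exprS sliceM // IH.
by rewrite !expr0 -[1 in LHS](rmorph1 (real_complex R)) slice_real rmorph1.
Qed.

Lemma sliceC u (a b : R[i]) : u * u = -1 -> slice u a * slice u b = slice u b * slice u a.
Proof. by move=> uu; rewrite -!sliceM // mulrC. Qed.

Lemma slice_eq0 u (a : R[i]) : u * u = -1 -> slice u a = 0 -> a = 0.
Proof.
move=> uu a0; apply/eqP; apply: contraT => na.
have := sliceX (a / a) 0 uu; rewrite expr0 -(divff na) sliceM // a0 mul0r expr0.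
by move/esym/eqP; rewrite oner_eq0.
Qed.

Lemma quat_slice (x : H) : exists u (a : R[i]), u * u = -1 /\ x = slice u a.
Proof.
pose n := qi x ^+ 2 + qj x ^+ 2 + qk x ^+ 2.
have n_ge0 : 0 <= n by rewrite !addr_ge0 ?sqr_ge0.
have [n0|n0] := eqVneq n 0.
  (* a real quaternion lies in every slice *)
  exists (Quat 0 1 0 0), (qre x)%:C%C; split; first by apply: quatP; split=> /=; ring.
  rewrite slice_real; move: n0; rewrite /n => n0.
  have := sqr_ge0 (qi x); have := sqr_ge0 (qj x); have := sqr_ge0 (qk x) => h2 h3 h4.
  apply: quatP; split=> //=; apply/eqP; rewrite -sqrf_eq0; apply/eqP; move: n0 h2 h3 h4; lra.
pose s := Num.sqrt n; have ss : s ^+ 2 = n by rewrite sqr_sqrtr.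
have s0 : s != 0 by rewrite -sqrf_eq0 ss.
exists (Quat 0 (qi x / s) (qj x / s) (qk x / s)), (Complex (qre x) s).
split; last by rewrite /slice; apply: quatP; split=> /=; field.
apply: quatP; split=> /=; try by ring.
have -> : 0 * 0 - qi x / s * (qi x / s) - qj x / s * (qj x / s)
    - qk x / s * (qk x / s) = - (n / s ^+ 2).
  by rewrite /n; field.
by rewrite ss divff.
Qed.

(** [rpart] and [ipart] are the two components of the value of P in the algebra of
complexified quaternions at the complex point (a, b); they do not depend on the
imaginary unit that is chosen to embed the complex numbers. *)
Definition rpart (a b : R[i]) := pairing (fun n m => qreal (complex.Re (a ^+ n * b ^+ m))).
Definition ipart (a b : R[i]) := pairing (fun n m => qreal (complex.Im (a ^+ n * b ^+ m))).

Lemma qeval_slice u (a b : R[i]) P : u * u = -1 ->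
  qeval P (slice u a, slice u b) = rpart a b P + u * ipart a b P.
Proof.
by move=> uu; rewrite qevalP; apply: pairing_comb => n m /=; rewrite -!sliceX // -sliceM.
Qed.

(** Write x = slice v a.  The values of P at all points (slice w a, y) are
rho + w sig for the same rho and sig.  If I vanishes at (x, y), then P and P * q2,
for P in I, give rho + v sig = 0 and y rho + v y sig = 0; as v does not commute
with y, rho = sig = 0.  So I vanishes on the whole sphere of x, which meets the
slice of y in slice u a and slice (- u) a; conversely, the values at these two
points determine rho and sig. *)
Lemma noncommuting_zero (I : set A) (x y : H) : right_ideal I -> x * y <> y * x ->
  zero_locus I (x, y) ->
  exists x1 x2, [/\ x1 * y = y * x1, x2 * y = y * x2,
    zero_locus I (x1, y), zero_locus I (x2, y)
    & forall P, qeval P (x1, y) = 0 -> qeval P (x2, y) = 0 -> qeval P (x, y) = 0].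
Proof.
move=> [_ _ IM] xy zxy.
have [v [a [vv xE]]] := quat_slice x.
have [u [b [uu yE]]] := quat_slice y.
pose rho := pairing (fun n m => qreal (complex.Re (a ^+ n)) * y ^+ m).
pose sig := pairing (fun n m => qreal (complex.Im (a ^+ n)) * y ^+ m).
have ev (w : H) P : w * w = -1 -> qeval P (slice w a, y) = rho P + w * sig P.
  move=> ww; rewrite qevalP; apply: pairing_comb => n m /=.
  by rewrite -sliceX // /slice mulrDl mulrA.
have ev2 (w : H) P : w * w = -1 ->
    qeval (P * mono 0 1 1) (slice w a, y) = y * rho P + w * (y * sig P).
  move=> ww; elim/slice_poly_ind: P => [|P Q IH IH'|n m c].
  - by rewrite mul0r qeval0 /rho /sig !pairing0 !mulr0 addr0.
  - by rewrite mulrDl qevalD IH IH' /rho /sig !pairingD !mulrDr addrACA.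
  rewrite monoM qeval_mon /rho /sig !pairing_mono addn0 addn1 mulr1 -sliceX //=.
  rewrite exprS /slice !mulrDl; congr (_ + _).
    by rewrite !mulrA (qrealC _ y).
  by rewrite -!mulrA; congr (w * _); rewrite !mulrA (qrealC _ y).
have vy : v * y <> y * v.
  move=> vy; apply: xy; rewrite xE /slice mulrDl mulrDr (qrealC _ y) -mulrA.
  by rewrite (qrealC _ y) !mulrA vy.
have van P : I P -> rho P = 0 /\ sig P = 0.
  move=> IP; have := zxy _ IP; rewrite xE ev // => e1.
  have := zxy _ (IM _ (mono 0 1 1) IP); rewrite xE ev2 // => e2.
  have : (v * y - y * v) * sig P =
      (y * rho P + v * (y * sig P)) - y * (rho P + v * sig P).
    by rewrite mulrBl mulrDr opprD addrACA subrr add0r !mulrA.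
  rewrite e1 e2 mulr0 subr0.
  case/quat_mulf_eq0 => [/subr0_eq //|s0].
  by move: e1; rewrite s0 mulr0 addr0.
have uN : - u * - u = -1 by rewrite mulrNN.
have uy : slice u a * y = y * slice u a by rewrite yE sliceC.
have uy' : slice (- u) a * y = y * slice (- u) a.
  have uyc : u * y = y * u.
    rewrite yE /slice mulrDl mulrDr (qrealC _ u).
    by rewrite -(mulrA u) (qrealC _ u) !mulrA.
  by rewrite /slice mulrDl mulrDr (qrealC _ y) -mulrA (qrealC _ y) !mulrA mulNr mulrN uyc.
exists (slice u a), (slice (- u) a); split=> //.
- by move=> P /van[r0 s0]; rewrite ev // r0 s0 mulr0 addr0.
- by move=> P /van[r0 s0]; rewrite ev // r0 s0 mulr0 addr0.
move=> P; rewrite xE !ev // => e1 e2.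
have us0 : u * (sig P) = 0.
  have : u * sig P + u * sig P = 0.
    have -> : 0 = (rho P + u * sig P) - (rho P + - u * sig P) by rewrite e1 e2 subr0.
    by rewrite mulNr opprD opprK addrACA subrr add0r.
  move=> e; apply: quatP; split.
  - by have /(congr1 (@qre R)) /= := e; lra.
  - by have /(congr1 (@qi R)) /= := e; lra.
  - by have /(congr1 (@qj R)) /= := e; lra.
  - by have /(congr1 (@qk R)) /= := e; lra.
have s0 : sig P = 0.
  case: (quat_mulf_eq0 us0) => // u0; move: uu; rewrite u0 mul0r => /eqP.
  by rewrite eq_sym oppr_eq0 oner_eq0.
by move: e1; rewrite s0 !mulr0 !addr0.
Qed.

End Pairing.

(** * Elimination of one variable *)

Section PrimeIdealExtension.
Import Pdiv.Idomain.

(** A root of g - 1 is not a root of g. *)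
Lemma closed_field_nonroot (F : closedFieldType) (g : {poly F}) :
  g != 0 -> exists b, g.[b] != 0.
Proof.
move=> g0; case: (leqP (size g) 1) => [sg|sg].
  by exists 0; move: g0; rewrite [g]size1_polyC // hornerC polyC_eq0.
have /closed_rootP[b] : size (g - 1) != 1.
  by rewrite size_polyDl ?size_polyN ?size_poly1 ?gtn_eqF.
rewrite /root hornerD hornerN hornerC => /eqP/subr0_eq gb.
by exists b; rewrite gb oner_eq0.
Qed.

(** The whole ring satisfies these conditions. *)
Record prime_ideal (D : comNzRingType) (p : set D) : Prop := PrimeIdeal {
  prime_ideal0 : p 0;
  prime_idealD : forall f g, p f -> p g -> p (f + g);
  prime_idealM : forall f g, p f -> p (f * g);
  prime_idealP : forall f g, p (f * g) -> p f \/ p g }.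

Lemma size_drop_lead (D : nzRingType) (f : {poly D}) : f != 0 ->
  (size (f - lead_coef f *: 'X^((size f).-1))%R < size f)%N.
Proof.
rewrite -size_poly_gt0 => sf; rewrite -[X in (_ < X)%N](prednK sf) ltnS.
apply/leq_sizeP => j lj; rewrite coefB coefZ coefXn.
have [->|nj] := eqVneq j (size f).-1; first by rewrite mulr1 subrr.
rewrite mulr0 subr0 nth_default // -(prednK sf).
by rewrite ltn_neqAle eq_sym nj.
Qed.

(** This is the induction step of the Nullstellensatz.  Let q be the trace of p on
D.  Every point of q at which e does not vanish lifts to a point of p at which c
does not vanish.  If p is generated by q, take for e a coefficient of c that is
not in q.  Otherwise let f be an element of p of least degree with a coefficient
outside q: modulo q, it generates p up to powers of its leading coefficient.
By primality p + (c) contains a constant t outside p, and e is the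
product of t with the leading coefficient of f; the lift is a root of f. *)
Lemma prime_ideal_extension (D : idomainType) (F : closedFieldType) (p : set {poly D})
    (c : {poly D}) :
  prime_ideal p -> ~ p c ->
  exists2 e : D, ~ p e%:P & forall phi : {rmorphism D -> F},
    (forall d, p d%:P -> phi d = 0) -> phi e != 0 ->
    exists2 b : F, (forall f, p f -> (map_poly phi f).[b] = 0)
                 & (map_poly phi c).[b] != 0.
Proof.
move=> [p0 pD pM pP] npc.
have pN f : p f -> p (- f) by move=> pf; rewrite -mulrN1; apply: pM.
have pB f g : p f -> p g -> p (f - g) by move=> pf pg; apply: pD => //; apply: pN.
have pMl f g : p g -> p (f * g) by rewrite mulrC; apply: pM.
have pZ d f : p f -> p (d *: f) by rewrite -mul_polyC; apply: pMl.
have pZV d f : p (d *: f) -> ~ p d%:P -> p f.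
  by rewrite -mul_polyC => /pP[].
have pXn k d : ~ p d%:P -> ~ p (d ^+ k)%:P.
  elim: k => [|k IH] nd; first by rewrite expr0 => /(pM _ c); rewrite mul1r.
  by rewrite exprS polyCM => /pP[//|]; apply: IH.
have pcoef (f : {poly D}) : (forall i, p (f`_i)%:P) -> p f.
  move=> pf; rewrite -[f]coefK poly_def; apply: (big_ind (fun x => p x) p0 pD) => i _.
  by rewrite -mul_polyC; apply: pM.
have [allq|] := pselect (forall f : {poly D}, p f -> forall i, p (f`_i)%:P).
  have [i npi] : exists i, ~ p (c`_i)%:P.
    by apply/existsNP => /pcoef.
  exists c`_i => // phi phiq phie.
  have [|b nb] := closed_field_nonroot (g := map_poly phi c).
    by apply: contraNneq phie => cp0; rewrite -coef_map cp0 coef0.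
  exists b => // f pf; suff -> : map_poly phi f = 0 by rewrite horner0.
  by apply/polyP => j; rewrite coef_map coef0; apply/phiq/allq.
move=> /existsNP[f0 /not_implyP[pf0 /existsNP[i0 nf0]]].
pose bad n := `[< exists f : {poly D}, [/\ p f, size f = n & exists i, ~ p (f`_i)%:P] >].
have : exists n, bad n by exists (size f0); apply/asboolP; exists f0; split=> //; exists i0.
move=> /ex_minnP[n /asboolP[f [pf sf [i npi]]] nmin].
have small (g : {poly D}) : p g -> (size g < n)%N -> forall j, p (g`_j)%:P.
  move=> pg sg j; apply: contrapT => npj.
  suff : (n <= size g)%N by rewrite leqNgt sg.
  by apply: nmin; apply/asboolP; exists g; split=> //; exists j.
have f_neq0 : f != 0 by apply: contra_notN npi => /eqP->; rewrite coef0.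
have lcf : ~ p (lead_coef f)%:P.
  move=> pl; pose g := f - lead_coef f *: 'X^((size f).-1).
  have pg : p g by apply: pB => //; rewrite -mul_polyC; apply: pM.
  have sg : (size g < n)%N by rewrite -sf size_drop_lead.
  have := small g pg sg i; rewrite coefB coefZ coefXn.
  have [iE|nj] := eqVneq i (size f).-1; first by move: npi; rewrite iE.
  by rewrite mulr0 subr0.
have sf1 : (1 < size f)%N.
  rewrite ltnNge; apply/negP => /size1_polyC fE; apply: lcf.
  by rewrite fE lead_coefC -fE.
(* J is the ideal p + (c); t is an element of J of least degree outside p *)
pose J (t : {poly D}) := exists u w : {poly D}, p w /\ t = u * c + w.
have JB t k g : J t -> J g -> J (k *: t - g).
  move=> [u [w [pw ->]]] [u' [w' [pw' ->]]].
  exists (k *: u - u'), (k *: w - w'); split; first by apply: pB => //; apply: pZ.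
  by rewrite -!mul_polyC; ring.
have JM t g : J t -> J (t * g).
  move=> [u [w [pw ->]]]; exists (u * g), (w * g); split; first exact: pM.
  by ring.
have Jp g : p g -> J g by move=> pg; exists 0, g; rewrite mul0r add0r.
pose good m := `[< exists t : {poly D}, [/\ J t, size t = m & ~ p t] >].
have : exists m, good m.
  exists (size c); apply/asboolP; exists c; split=> //.
  by exists 1, 0; rewrite mul1r addr0.
move=> /ex_minnP[m /asboolP[t [Jt st npt]] mmin].
have smallJ (g : {poly D}) : J g -> (size g < m)%N -> p g.
  move=> Jg sg; apply: contrapT => npg.
  suff : (m <= size g)%N by rewrite leqNgt sg.
  by apply: mmin; apply/asboolP; exists g.
have t_neq0 : t != 0 by apply: contra_notN npt => /eqP->.
(* otherwise the remainder of t modulo f would be smaller, hence in p *)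
have smf : (m < size f)%N.
  rewrite ltnNge; apply/negP => le_fm.
  have E := divp_eq t f; have rE : t %% f = lead_coef f ^+ scalp t f *: t - t %/ f * f.
    by rewrite E addrC addKr.
  have : p (t %% f).
    apply: smallJ; last by rewrite (leq_trans _ le_fm) // ltn_modp.
    by rewrite rE; apply: JB => //; apply: Jp; apply: pMl.
  move=> pr; apply: npt; apply: (pZV (lead_coef f ^+ scalp t f)); last exact: pXn.
  by rewrite E; apply: pD => //; apply: pMl.
have lct : ~ p (lead_coef t)%:P.
  move=> pl; apply: npt.
  have -> : t = (t - lead_coef t *: 'X^((size t).-1)) + lead_coef t *: 'X^((size t).-1).
    by rewrite subrK.
  have plt : p (lead_coef t *: 'X^((size t).-1)) by rewrite -mul_polyC; apply: pM.
  apply: pD => //; apply: smallJ.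
    by rewrite -[X in X - _]scale1r; apply: JB => //; apply: Jp.
  by rewrite -st size_drop_lead.
(* If t is not constant, divide f by t: the remainder is in J and smaller than t,
   so it is in p; by primality so is the quotient.  Both are smaller than f, so
   their coefficients are in q, and so is the leading coefficient of f. *)
have st1 : size t = 1%N.
  apply/eqP; rewrite eqn_leq size_poly_gt0 t_neq0 andbT leqNgt; apply/negP => st1.
  have E := divp_eq f t.
  have rE : f %% t = lead_coef t ^+ scalp f t *: f - f %/ t * t.
    by rewrite E addrC addKr.
  have pr : p (f %% t).
    apply: smallJ; last by rewrite -st ltn_modp.
    rewrite rE; apply: JB; first exact: Jp.
    by rewrite mulrC; apply: JM.
  have /pP[pq|//] : p (f %/ t * t).
    have -> : f %/ t * t = lead_coef t ^+ scalp f t *: f - f %% t by rewrite E addrK.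
    by apply: pB => //; apply: pZ.
  have sq : (size (f %/ t)%R < n)%N.
    rewrite size_divp // -sf ltn_subrL size_poly_gt0 f_neq0 andbT.
    by case: (size t) st1 => [|[]].
  have qq := small _ pq sq.
  have rr : forall j, p ((f %% t)`_j)%:P.
    by apply: small => //; rewrite -sf (ltn_trans _ smf) // -st ltn_modp.
  have : p ((lead_coef t ^+ scalp f t *: f)`_(size f).-1)%:P.
    rewrite E coefD polyCD; apply: (pD) => //.
    rewrite coefM (big_morph _ (polyCD (R := D)) (erefl _)).
    apply: (big_ind (fun x => p x) p0 pD) => k _; rewrite polyCM; exact: pM.
  by rewrite coefZ polyCM => /pP[|//]; apply: pXn.
have tE := size1_polyC (eq_leq st1); move: Jt => [u [w [pw twE]]].
exists (lead_coef f * t`_0).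
  by rewrite polyCM -tE => /pP[].
move=> phi phiq; rewrite rmorphM mulf_eq0 negb_or => /andP[phil phit].
have sfphi : size (map_poly phi f) = size f by rewrite size_poly_eq.
have /closed_rootP[b /rootP fb] : size (map_poly phi f) != 1.
  by rewrite sfphi gtn_eqF.
have pb g : p g -> (map_poly phi g).[b] = 0.
  move=> pg; have E := divp_eq g f.
  have pr : p (g %% f).
    have -> : g %% f = lead_coef f ^+ scalp g f *: g - g %/ f * f.
      by rewrite E addrC addKr.
    by apply: pB; [apply: pZ | apply: pMl].
  have r0 : map_poly phi (g %% f) = 0.
    apply/polyP => j; rewrite coef_map coef0; apply: phiq.
    by apply: small => //; rewrite -sf ltn_modp.
  have := congr1 (fun h => (map_poly phi h).[b]) E.
  rewrite /= map_polyZ hornerZ rmorphD rmorphM /= r0 addr0 hornerM fb mulr0.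
  by move/eqP; rewrite mulf_eq0 rmorphXn expf_eq0 (negPf phil) andbF => /eqP.
exists b => //; apply: contraNneq phit => cb.
have := congr1 (fun h => (map_poly phi h).[b]) twE.
rewrite /= {1}tE map_polyC hornerC /= => ->.
by rewrite rmorphD rmorphM /= hornerD hornerM cb mulr0 pb ?addr0.
Qed.

End PrimeIdealExtension.

(** * Completely prime right ideals *)

Section CompletelyPrime.
Variable R : realType.
Local Notation H := (quat R).
Local Notation A := (slice_poly R).
Local Notation C2 := {poly {poly R}}.
Implicit Types (P Q X Y w : A) (K : set A) (z : H * H) (f g : C2).

Lemma right_idealB K P Q : right_ideal K -> K P -> K Q -> K (P - Q).
Proof. by move=> [_ KD KM] KP KQ; apply: KD => //; rewrite -mulrN1; apply: KM. Qed.

Lemma prime_central K c X : completely_prime K -> pconj c = c ->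
  K (c * X) -> K c \/ K X.
Proof.
move=> [[_ _ KM] Kp] cr KcX; apply: Kp => // _ [S KS <-].
by rewrite pconj_fixC //; apply: KM.
Qed.

(** P is a right linear combination of its traces, by [ptr_expand]. *)
Lemma trace_in K P : right_ideal K -> (forall w, K (ptr (P * w))) -> K P.
Proof.
move=> [_ KD KM] KT; rewrite (ptr_expand P).
have T c d : K (ptr (P * qconst c) * qconst d) by apply/KM/KT.
by do 3!apply: (KD) => //.
Qed.

(** Suppose that all central elements of P A + K are in K; in particular this
holds for the norms of the elements of P A + K.  If all traces of elements of K
are in K, then K is a two-sided ideal stable under conjugation which contains
P * conj P, and complete primality puts P in K.  Otherwise some Q in K has
a trace outside K.  Polarizing the norm shows that tr (P * w * conj Q) is in K
for all w, so conj Q * P is in K by [trace_in], hence so is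
tr Q * P = Q * P + conj Q * P, and P is in K because tr Q is central. *)
Lemma prime_real_witness K P : completely_prime K -> ~ K P ->
  exists f, ~ K (preal f) /\ exists Q S, K S /\ preal f = P * Q + S.
Proof.
move=> Kcp nKP; have [Kr Kp] := Kcp; have [K0 KD KM] := Kr.
apply: contrapT => nex.
have hyp Q S : K S -> pconj (P * Q + S) = P * Q + S -> K (P * Q + S).
  move=> KS /pconj_real[f fE]; apply: contrapT => nK; apply: nex; exists f.
  by split; [rewrite -fE | exists Q, S].
have Knorm Q S : K S -> K (pnorm (P * Q + S)).
  move=> KS; have E : pnorm (P * Q + S) = P * (Q * pconj (P * Q + S)) + S * pconj (P * Q + S).
    by rewrite /pnorm {1}mulrDl mulrA.
  by rewrite E; apply: hyp; [apply: KM | rewrite -E pconj_norm].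
have [KT|] := pselect (forall Q, K Q -> forall w, K (ptr (Q * w))).
  have KP : K (P * pconj P).
    by have := Knorm 1 0 K0; rewrite mulr1 addr0.
  case: (Kp P (pconj P) KP) => // [_ [S KS <-]|KPc].
    apply: (trace_in Kr) => w; rewrite -mulrA ptrC -mulrA; exact: KT.
  apply: nKP; apply: (trace_in Kr) => w.
  rewrite ptrC; have -> : ptr (w * P) = ptr (pconj P * pconj w).
    by rewrite -pconjM /ptr pconjK addrC.
  exact: KT.
move=> /existsNP[Q0 /not_implyP[KQ0 /existsNP[w0]]].
have : K (Q0 * w0) by apply: KM.
move: (Q0 * w0) => Q KQ nKd.
have KPQ w : K (ptr (P * w * pconj Q)).
  have -> : ptr (P * w * pconj Q) = pnorm (P * w + Q) - pnorm (P * w + 0) - pnorm Q.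
    rewrite addr0 pnormD; move: (pnorm _) (pnorm _) (ptr _) => y x t.
    by rewrite -(addrA x) (addrC x) addrK (addrC y) addrK.
  apply: (right_idealB Kr); last exact: KM.
  by apply: (right_idealB Kr); apply: Knorm.
have KQP : K (pconj Q * P).
  by apply: (trace_in Kr) => w; rewrite -mulrA ptrC; apply: KPQ.
have /prime_central : K (ptr Q * P) by rewrite /ptr mulrDl; apply: KD => //; apply: KM.
by case=> //; apply: pconj_tr.
Qed.

Definition ceval (a b : R[i]) f : R[i] :=
  (map_poly (horner_eval b \o map_poly (real_complex R)) f).[a].

Lemma qeval_preal u (a b : R[i]) f : u * u = -1 ->
  qeval (preal f) (slice u a, slice u b) = slice u (ceval a b f).
Proof.
move=> uu; set z := (_, _); have zC : z.1 * z.2 = z.2 * z.1 by rewrite sliceC.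
have EM g h : qeval (preal (g * h)) z = qeval (preal h) z * qeval (preal g) z.
  by rewrite rmorphM qevalM // -prealC qevalMr.
have ED g h : qeval (preal (g + h)) z = qeval (preal h) z + qeval (preal g) z.
  by rewrite raddfD qevalD addrC.
rewrite /ceval; elim/poly_ind: f => [|f c IH].
  by rewrite !raddf0 horner0 qeval0 /slice !rmorph0 mulr0 addr0.
rewrite ED EM rmorphD rmorphM /= map_polyX hornerD hornerMX sliceD sliceM //.
rewrite addrC sliceC // -IH; congr (_ * _ + _).
  have -> : preal ('X : C2) = mono 1 0 1.
    by rewrite prealE monoE map_polyX expr0 expr1 !mulr1 mul1r.
  by rewrite qeval_mon expr0 expr1 !mulr1.
rewrite map_polyC hornerC /= /horner_eval.
elim/poly_ind: c => [|c d IHc].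
  by rewrite !raddf0 horner0 qeval0 /slice !rmorph0 mulr0 addr0.
rewrite polyCD polyCM ED EM rmorphD rmorphM /= map_polyX map_polyC hornerD hornerMX hornerC.
rewrite addrC sliceD sliceM // sliceC // -IHc; congr (_ * _ + _).
  have -> : preal (('X)%:P : C2) = mono 0 1 1.
    rewrite prealE monoE map_polyC /= map_polyX expr0 expr1.
    by rewrite mulr1 mul1r.
  by rewrite qeval_mon expr0 expr1 mul1r mulr1.
have -> : preal d%:P%:P = qconst (qreal d).
  by rewrite prealE qconst.unlock !map_polyC /= map_polyC.
by rewrite qeval_const /= slice_real.
Qed.

(** Eliminate q1 to get an obstruction e in R[q2], then q2; the coordinate b is
chosen first, and a over it. *)
Lemma real_nullstellensatz (p : set C2) f : prime_ideal p -> ~ p f ->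
  exists a b : R[i], (forall g, p g -> ceval a b g = 0) /\ ceval a b f <> 0.
Proof.
move=> pp npf; have [p0 pD pM pP] := pp.
have [e npe ext] := prime_ideal_extension R[i] pp npf.
have pp' : prime_ideal [set g : {poly R} | p g%:P].
  split=> /= [|g h|g h|g h].
  - by rewrite polyC0.
  - by rewrite polyCD; apply: pD.
  - by rewrite polyCM; apply: pM.
  - by rewrite polyCM; apply: pP.
have [e' npe' ext'] := prime_ideal_extension R[i] pp' npe.
have [|| b b0 be] := ext' (real_complex R).
- move=> d pd; have [->|d0] := eqVneq d 0; first exact: raddf0.
  case: npf; have -> : f = d%:P%:P * (d^-1%:P%:P * f).
    by rewrite mulrA -!polyCM divff // mul1r.
  exact: pM.
- by apply: contra_notN npe' => /=; rewrite fmorph_eq0 => /eqP->; rewrite !polyC0.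
have [|| a a0 af] := ext (horner_eval b \o map_poly (real_complex R)).
- exact: b0.
- exact: be.
by exists a, b; split=> //; apply/eqP.
Qed.

(** For P in K with complexified value (r, s), the vanishing of the norm says
|r| = |s| and Re (r conj s) = 0.  If some s is nonzero, right multiplication by
its inverse gives an element P1 of K with value (- u, 1), and then u^2 = -1.  For
any other P in K, subtracting P1 * s leaves the value (r + u s, 0), of vanishing
norm, so r + u s = 0. *)
Lemma right_ideal_slice K (a b : R[i]) : right_ideal K ->
  (forall P f, K P -> pnorm P = preal f -> ceval a b f = 0) ->
  exists2 u : H, u * u = -1 & forall P, K P -> qeval P (slice u a, slice u b) = 0.
Proof.
move=> [K0 KD KM] Knorm.
pose r := rpart a b; pose s := ipart a b; pose i : H := Quat 0 1 0 0.
have ii : i * i = -1 by apply: quatP; split=> /=; ring.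
pose z := (slice i a, slice i b).
have zC : z.1 * z.2 = z.2 * z.1 by rewrite sliceC.
have normE P : K P -> qnorm (r P) = qnorm (s P) /\ qre (r P * qconj (s P)) = 0.
  move=> KP; have [f fE] := pconj_real (pconj_norm P).
  (* the value of the norm of P at z, computed by qevalM *)
  have e : (r P + i * s P) * qconj (r P) + i * ((r P + i * s P) * qconj (s P)) = 0.
    rewrite -(qeval_slice a b P ii) -/z.
    rewrite -[r]/(rpart a b) -[s]/(ipart a b) -!pairing_real_conj -2!pairing_real_mull.
    rewrite -[LHS](qeval_slice a b _ ii) -/z -qevalM ?zC //.
    by rewrite -/(pnorm P) fE qeval_preal // (Knorm P) // /slice !rmorph0 mulr0 addr0.
  rewrite /qnorm; move: e; rewrite /i; move: (r P) (s P) => [x0 x1 x2 x3] [y0 y1 y2 y3] e.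
  have /(congr1 (@qre R)) /= := e; have /(congr1 (@qi R)) /= := e.
  by move=> e1 e2; split; [move: e2 | move: e1]; lra.
have rD P Q : r (P + Q) = r P + r Q by exact: pairingD.
have sD P Q : s (P + Q) = s P + s Q by exact: pairingD.
have rM P c : r (P * qconst c) = r P * c by exact: pairing_mulr.
have sM P c : s (P * qconst c) = s P * c by exact: pairing_mulr.
have norm0 : qnorm (0 : H) = 0 by rewrite /qnorm /= !expr0n /= !addr0.
have s0r0 P : K P -> s P = 0 -> r P = 0.
  by move=> KP sP; have [] := normE P KP; rewrite sP norm0 => /qnorm_eq0.
have [s0|] := pselect (forall P, K P -> s P = 0).
  exists i => // P KP; rewrite qeval_slice // -/(r P) -/(s P) s0 // s0r0 ?s0 //.
  by rewrite mulr0 addr0.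
move=> /existsNP[P0 /not_implyP[KP0 /eqP sP0]].
pose P1 := P0 * qconst (qinv (s P0)).
have KP1 : K P1 by apply: KM.
have sP1 : s P1 = 1 by rewrite sM qmulV.
have uu : - r P1 * - r P1 = -1.
  have [] := normE P1 KP1; rewrite sP1 /qnorm mulrNN.
  by case: (r P1) => x1 x2 x3 x4 /= e1 e2; apply: quatP; split=> /=; nra.
exists (- r P1) => // P KP; rewrite qeval_slice // -/(r P) -/(s P).
have KP' : K (P + P1 * qconst (- s P)) by apply: KD => //; apply: KM.
have := s0r0 _ KP'; rewrite rD sD rM sM sP1 mul1r subrr mulrN mulNr; exact.
Qed.

(** A completely prime right ideal is the intersection of the ideals M_z that
contain it. *)
Lemma completely_prime_point K P : completely_prime K -> ~ K P ->
  exists z, [/\ z.1 * z.2 = z.2 * z.1, zero_locus K z & qeval P z <> 0].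
Proof.
move=> Kcp nKP; have [Kr _] := Kcp; have [K0 KD KM] := Kr.
have [f [nKf [Q [S [KS fE]]]]] := prime_real_witness Kcp nKP.
have pp : prime_ideal [set g : C2 | K (preal g)].
  split=> /= [|g h|g h|g h].
  - by rewrite raddf0.
  - by rewrite raddfD; apply: KD.
  - by rewrite rmorphM; apply: KM.
  - rewrite rmorphM; apply: prime_central => //; apply: slice_polyP => n m.
    by rewrite coef_pconj coef_preal; apply: quatP; split=> //=; rewrite oppr0.
have [a [b [Kz fz]]] := real_nullstellensatz pp nKf.
have [X g KX gE|u uu Ku] := right_ideal_slice (a := a) (b := b) Kr.
  by apply: Kz; rewrite /= -gE; apply: KM.
have zC : slice u a * slice u b = slice u b * slice u a by rewrite sliceC.
exists (slice u a, slice u b); split=> // Pz; apply: fz; apply: (slice_eq0 uu).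
rewrite -qeval_preal // fE qevalD (Ku _ KS) addr0.
by rewrite qevalM // Pz qconst0 mul0r qeval0.
Qed.

End CompletelyPrime.

(** * The Nullstellensatz *)

Theorem mainTheorem1 (R : realType) (I : set (slice_poly R)) (hI : right_ideal I) :
  Jideal (zero_locus I) = right_radical I /\
  right_radical I = vanishing (zero_locus I).
Proof.
have van_commuting P : (forall z, z.1 * z.2 = z.2 * z.1 -> zero_locus I z -> qeval P z = 0) ->
    vanishing (zero_locus I) P.
  move=> van [x y] Iz; have [xy|xy] := pselect (x * y = y * x); first exact: van.
  have [x1 [x2 [C1 C2 I1 I2 H]]] := noncommuting_zero hI xy Iz.
  by apply: H; apply: van.
have rad_van : right_radical I = vanishing (zero_locus I).
  apply/seteqP; split=> P.
    move=> radP; apply: van_commuting => z zC Iz; apply: (radP (point_ideal z)).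
    by split; [apply: point_ideal_prime | move=> Q IQ; apply: Iz].
  move=> van K [Kcp IK]; apply: contrapT => nKP.
  have [z [zC Kz]] := completely_prime_point Kcp nKP; apply.
  by apply: van => Q /IK; apply: Kz.
split=> //; rewrite rad_van; apply/seteqP; split=> P.
  move=> [N [X [Y [_ van ->]]]]; apply: van_commuting => z zC Iz.
  have [M0 MD MM] := point_ideal_right zC.
  apply: (big_ind (point_ideal z) M0 MD) => k _; apply: MM.
  exact: van.
move=> van; exists 1%N, (fun=> P), (fun=> 1); split=> //.
by rewrite big_ord1 mulr1.
Qed.
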